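(* Let $k\ge2$. If ALG is an online algorithm for Edge-$k$-Coloring(Tree) that is deterministic or fair, then $C_{\mathrm{ALG}}^{\text{Tree}}(k)\le\frac{k-1}{k}$.
   Context: Online dual edge coloring, Edge-$k$-Coloring: a number $k$ of colors $1,\dots,k$ is given. The edges of a simple graph arrive one by one, each specified by its two endpoints. Upon arrival, an edge must irrevocably either be colored with one of the $k$ colors, such that no two adjacent (sharing an endpoint) colored edges receive the same color, or be rejected. The goal is to color as many edges as possible. Edge-$k$-Coloring(Tree) denotes the restriction to inputs whose graph is a tree. Competitive ratio: for an input sequence $\sigma$, let $\mathrm{ALG}(\sigma)$ be the (expected, for randomized algorithms) number of edges colored by ALG and $\mathrm{OPT}(\sigma)$ the maximum number of edges of the input graph that can be properly colored with $k$ colors. ALG is $C$-competitive if there is a constant $b$ with $\mathrm{ALG}(\sigma)\ge C\cdot\mathrm{OPT}(\sigma)-b$ for all inputs $\sigma$; the competitive ratio $C_{\mathrm{ALG}}^{\text{Tree}}(k)$ is the supremum of all such $C$. An algorithm is fair if it never rejects an edge unless all $k$ colors are already used on edges adjacent to it. *)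

(* Defs.v *)
From HB Require Import structures.
From mathcomp Require Import all_boot all_order all_algebra.
From mathcomp Require Import all_classical all_reals all_analysis.

Set Implicit Arguments.
Unset Strict Implicit.
Unset Printing Implicit Defensive.

Import Order.TTheory GRing.Theory Num.Theory.

(* The edge {u, v} with u < v is encoded as (u, v); the condition u < v is
   imposed by [simple_graph], so each unordered pair has a unique code. *)
Definition edge : Type := (nat * nat)%type.

Definition incident (e : edge) : seq nat := [:: e.1; e.2].

Definition adjacent (e f : edge) : bool := has (mem (incident f)) (incident e).

Definition simple_graph (s : seq edge) : bool :=
  uniq s && all (fun e : edge => e.1 < e.2) s.

(* The graph of s has as vertices the endpoints of its edges. *)
Definition vertices (s : seq edge) : seq nat := flatten (map incident s).

Definition neighbor (s : seq edge) : rel nat :=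
  fun u v => ((u, v) \in s) || ((v, u) \in s).

Definition connected_graph (s : seq edge) : Prop :=
  {in vertices s &, forall u v,
    exists p : seq nat, path (neighbor s) u p /\ last u p = v}.

Definition acyclic_graph (s : seq edge) : Prop :=
  forall c : seq nat, 2 < size c -> ~ ucycle (neighbor s) c.

(* Only the whole input has to be a tree: a proper prefix may be any forest. *)
Definition tree_input (s : seq edge) : Prop :=
  [/\ simple_graph s, connected_graph s & acyclic_graph s].

(* [None] means that the edge is rejected. *)
Definition coloring (k : nat) (s : seq edge) : Type :=
  {ffun 'I_(size s) -> option 'I_k}.

Definition edge_at (s : seq edge) (i : 'I_(size s)) : edge := tnth (in_tuple s) i.

Definition proper_coloring (k : nat) (s : seq edge) (c : coloring k s) : bool :=
  [forall i, forall j,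
    [&& i != j, adjacent (edge_at i) (edge_at j) & c i != None] ==> (c i != c j)].

Definition colored (k : nat) (s : seq edge) (c : coloring k s) : nat :=
  #|[set i | c i != None]|.

Definition OPT (k : nat) (s : seq edge) : nat :=
  \max_(c : {ffun 'I_(size s) -> option 'I_k} | proper_coloring c) colored c.

(* A deterministic strategy [A past e] decides on the arriving edge e knowing
   the edges that arrived before it; its own past decisions are determined by
   these.  A randomized algorithm is a random strategy [ALG : Omega -> strategy k]
   over a probability space. *)
Definition strategy (k : nat) : Type := seq edge -> edge -> option 'I_k.

Definition run (k : nat) (A : strategy k) (s : seq edge) : coloring k s :=
  [ffun i : 'I_(size s) => A (take i s) (edge_at i)].

Local Open Scope classical_set_scope.
Local Open Scope ring_scope.

Definition online_tree_algorithm (d : measure_display) (Omega : measurableType d)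
    (k : nat) (ALG : Omega -> strategy k) : Prop :=
  (forall (past : seq edge) (e : edge) (a : option 'I_k),
     measurable [set w | ALG w past e = a]) /\
  (forall (w : Omega) (s : seq edge),
     tree_input s -> proper_coloring (run (ALG w) s)).

Definition deterministic (Omega : Type) (k : nat) (ALG : Omega -> strategy k) : Prop :=
  exists A : strategy k, forall w past e, ALG w past e = A past e.

Definition fair (Omega : Type) (k : nat) (ALG : Omega -> strategy k) : Prop :=
  forall (w : Omega) (s : seq edge), tree_input s ->
  forall i : 'I_(size s), run (ALG w) s i = None ->
  forall a : 'I_k, exists j : 'I_(size s),
    [/\ (j < i)%N, adjacent (edge_at j) (edge_at i) & run (ALG w) s j = Some a].

Definition expected_colored (R : realType) (d : measure_display)
    (Omega : measurableType d) (P : probability Omega R) (k : nat)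
    (ALG : Omega -> strategy k) (s : seq edge) : \bar R :=
  'E_P[fun w : Omega => (colored (run (ALG w) s))%:R : R].

Definition tree_competitive (R : realType) (d : measure_display)
    (Omega : measurableType d) (P : probability Omega R) (k : nat)
    (ALG : Omega -> strategy k) (C : R) : Prop :=
  exists b : R, forall s : seq edge, tree_input s ->
    ((C * (OPT k s)%:R - b)%:E <= expected_colored P ALG s)%E.

Definition tree_competitive_ratio (R : realType) (d : measure_display)
    (Omega : measurableType d) (P : probability Omega R) (k : nat)
    (ALG : Omega -> strategy k) : \bar R :=
  ereal_sup [set C%:E | C in [set C : R | tree_competitive P ALG C]].

(* Main.v *)
(** The adversary grows a caterpillar: each spine vertex in turn receives [k.+1]
    new children, one of which becomes the next spine vertex.  OPT can reject the
    spine edges and colour the [k] other children of each of the [m] spine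
    vertices, that is [m * k] edges.  A vertex carries at most [k] coloured edges,
    and a coloured spine edge is counted at both its ends, so ALG gets at most
    [m * (k - 1) + 1] edges as soon as each spine vertex either has a coloured edge
    to its successor or has no coloured child at all.  Against a deterministic
    algorithm the successor is chosen among the coloured children; a fair one
    always colours the first child, so there the input can be fixed in advance,
    whatever the random choices. *)

Require Import Defs.
From HB Require Import structures.
From mathcomp Require Import all_boot all_order all_algebra.
From mathcomp Require Import all_classical all_reals all_analysis.
From mathcomp Require Import measurable_realfun zify lra.
Set Implicit Arguments.
Unset Strict Implicit.
Unset Printing Implicit Defensive.

Import Order.TTheory GRing.Theory Num.Theory.

(** * Trees grown from a parent function *)

Definition parent_edge (p : nat -> nat) (n : nat) : edge := (p n, n.+1).

(** When [p n <= n], edge [n] hangs the new vertex [n.+1] below an older one, so every prefix is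
    itself a tree rooted at 0. *)
Definition parent_seq (p : nat -> nat) (N : nat) : seq edge :=
  mkseq (parent_edge p) N.

Lemma mem_parent_seq p N u v :
  ((u, v) \in parent_seq p N) = [&& 0 < v, v <= N & u == p v.-1].
Proof.
apply/mapP/idP => [[n]|/and3P[v0 vN /eqP->]].
  by rewrite mem_iota => /andP[_ nN] [-> ->] /=; rewrite eqxx andbT.
exists v.-1; first by rewrite mem_iota; lia.
by rewrite /parent_edge prednK.
Qed.

Lemma neighbor_sym s : symmetric (neighbor s).
Proof. by move=> u v; rewrite /neighbor orbC. Qed.

Lemma acyclic_parent_seq p N :
  (forall n, p n <= n) -> acyclic_graph (parent_seq p N).
Proof.
move=> p_le c c2 /andP[ce cu].
(* The two neighbours of the largest vertex of a cycle are both its parent. *)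
have lower x y : neighbor (parent_seq p N) x y -> y <= x -> y = p x.-1.
  rewrite /neighbor !mem_parent_seq => /orP[|] /and3P[? ? /eqP->] //.
  by have := p_le y.-1; lia.
have [x xc x_max] : exists2 x, x \in c & {in c, forall y, y <= x}.
  have c_ex : exists x, x \in c.
    by case: c c2 {ce cu} => // x c; exists x; exact: mem_head.
  have c_bound y : y \in c -> y <= \max_(z <- c) z by move=> yc; exact: leq_bigmax_seq.
  by case: (ex_maxnP c_ex c_bound) => x; exists x.
have [i c' Ec] := rot_to xc.
move: ce cu c2; rewrite -(rot_cycle i) -(rot_uniq i) -(size_rot i) Ec.
have {}x_max : {in c', forall y, y <= x}.
  by move=> y yc'; apply: x_max; rewrite -(mem_rot i) Ec inE yc' orbT.
case: c' x_max {Ec} => [|y [|z c']] // x_max /=.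
rewrite rcons_path => /and3P[exy _ /andP[_ ezx]] /and3P[_ yc' _] _.
rewrite /= neighbor_sym in ezx.
have zc' : last z c' \in z :: c' by exact: mem_last.
have Ey := lower _ _ exy (x_max y (mem_head _ _)).
have Ez : last z c' = p x.-1.
  by apply: lower ezx _; apply: x_max; rewrite inE zc' orbT.
by rewrite Ey -Ez zc' in yc'.
Qed.

(** Following parents leads from every vertex to 0. *)
Lemma connected_parent_seq p N :
  (forall n, p n <= n) -> connected_graph (parent_seq p N).
Proof.
move=> p_le.
pose linked u v := exists q, path (neighbor (parent_seq p N)) u q /\ last u q = v.
have linked_trans u v w : linked u v -> linked v w -> linked u w.
  move=> [q [eq lq]] [r [er lr]]; exists (q ++ r).
  by rewrite cat_path last_cat lq eq er.
have linked_sym u v : linked u v -> linked v u.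
  move=> [q [eq lq]]; exists (rev (belast u q)); split.
    by rewrite -lq rev_path; under eq_path do rewrite neighbor_sym.
  by case: q eq lq => [|x q] //= _ _; rewrite rev_cons last_rcons.
have linked0 u : u <= N -> linked u 0.
  elim/ltn_ind: u => -[|u] IHu uN; first by exists [::].
  apply: (@linked_trans _ (p u)); last by apply: IHu; have := p_le u; lia.
  exists [:: p u]; split=> //=; rewrite andbT /neighbor !mem_parent_seq /=.
  by rewrite uN eqxx orbT.
have vertexP u : u \in vertices (parent_seq p N) -> u <= N.
  move=> /flatten_mapP[[a b]]; rewrite mem_parent_seq => /and3P[b0 bN /eqP->].
  by rewrite !inE => /orP[] /eqP-> //=; have := p_le b.-1; lia.
move=> u v /vertexP uN /vertexP vN.
exact: linked_trans (linked0 u uN) (linked_sym _ _ (linked0 v vN)).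
Qed.

Lemma tree_parent_seq p N :
  (forall n, p n <= n) -> tree_input (parent_seq p N).
Proof.
move=> p_le; split; last exact: acyclic_parent_seq.
  rewrite /simple_graph mkseq_uniq; last by move=> m n [_ ->].
  by apply/allP => e /mapP[n _ ->] /=; rewrite ltnS.
exact: connected_parent_seq.
Qed.

(** * Colourings as functions of the edge index *)

(** An online decision sees only the prefix, so it depends on the index [n] and not on the length of
    the input. *)
Definition decision {k} (A : strategy k) (p : nat -> nat) (n : nat) : option 'I_k :=
  A (parent_seq p n) (parent_edge p n).

Lemma edge_at_parent_seq p N (i : 'I_(size (parent_seq p N))) :
  edge_at i = parent_edge p i.
Proof.
rewrite /edge_at (tnth_nth (0, 0)) nth_mkseq //.
by apply: leq_trans (ltn_ord i) _; rewrite size_mkseq.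
Qed.

Lemma run_parent_seq k (A : strategy k) p N (i : 'I_(size (parent_seq p N))) :
  run A (parent_seq p N) i = decision A p i.
Proof.
rewrite ffunE edge_at_parent_seq /decision; congr (A _ _).
have iN : i < N by apply: leq_trans (ltn_ord i) _; rewrite size_mkseq.
by rewrite /parent_seq /mkseq -map_take take_iota (minn_idPl (ltnW iN)).
Qed.

Lemma colored_count k s (c : coloring k s) (D : nat -> option 'I_k) :
  (forall i : 'I_(size s), c i = D i) ->
  colored c = count (fun n => D n != None) (iota 0 (size s)).
Proof.
move=> cD; rewrite /colored -sum1_card.
under eq_bigl => i do rewrite inE cD.
by rewrite -(big_mkord (fun n => D n != None) (fun=> 1)) sum1_count /index_iota subn0.
Qed.

Definition proper_decision k (p : nat -> nat) (D : nat -> option 'I_k) :=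
  forall m n, m != n -> Defs.adjacent (parent_edge p m) (parent_edge p n) ->
  D m != None -> D m != D n.

(** Both edges lie in the prefix of length [(maxn m n).+1], which is a tree input. *)
Lemma proper_decision_run k (A : strategy k) p :
  (forall n, p n <= n) ->
  (forall s, tree_input s -> proper_coloring (run A s)) ->
  proper_decision p (decision A p).
Proof.
move=> p_le A_proper m n m_n adj_mn Dm.
have tN := tree_parent_seq (maxn m n).+1 p_le.
have bound j : j <= maxn m n -> j < size (parent_seq p (maxn m n).+1).
  by rewrite size_mkseq ltnS.
have /forallP/(_ (Ordinal (bound m (leq_maxl _ _)))) := A_proper _ tN.
move=> /forallP/(_ (Ordinal (bound n (leq_maxr _ _)))).
by rewrite !edge_at_parent_seq !run_parent_seq /= -val_eqE /= m_n adj_mn Dm.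
Qed.

Lemma proper_decision_coloring k p N (D : nat -> option 'I_k) :
  proper_decision p D ->
  proper_coloring ([ffun i => D (val i)] : coloring k (parent_seq p N)).
Proof.
move=> D_proper; apply/forallP => i; apply/forallP => j; rewrite !ffunE.
apply/implyP => /and3P[ij]; rewrite !edge_at_parent_seq => adj Di.
exact: D_proper.
Qed.

Lemma adjacent_parent_edge p m n :
  Defs.adjacent (parent_edge p m) (parent_edge p n) =
  [|| p m == p n, p m == n.+1, m.+1 == p n | m == n].
Proof. by rewrite /Defs.adjacent /= !inE orbF eqSS -!orbA. Qed.

(** Coloured edges sharing [u] are pairwise adjacent, so [D] maps them injectively into the [k]
    values other than [None]. *)
Lemma proper_count k p (D : nat -> option 'I_k) u (l : seq nat) :
  proper_decision p D -> uniq l -> {in l, forall n, u \in incident (parent_edge p n)} ->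
  count (fun n => D n != None) l <= k.
Proof.
move=> D_proper l_uniq lu; rewrite -size_filter; set l' := [seq _ <- _ | _].
have l'D : {in l', forall n, D n != None} by move=> n; rewrite mem_filter => /andP[].
have uD : uniq (map D l').
  rewrite map_inj_in_uniq ?filter_uniq // => m n ml nl Dmn; apply/eqP.
  have ml' := l'D _ ml; apply: contraT => mn.
  suff adj : Defs.adjacent (parent_edge p m) (parent_edge p n).
    by have := D_proper m n mn adj ml'; rewrite Dmn eqxx.
  move: ml nl; rewrite !mem_filter => /andP[_ /lu um] /andP[_ /lu un].
  by apply/hasP; exists u.
rewrite -(size_map D) -(card_uniqP uD).
apply: (@leq_trans #|predC1 (None : option 'I_k)|).
  by apply/subset_leq_card/fintype.subsetP => _ /mapP[n nl' ->]; rewrite inE; exact: l'D.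
by have := cardC1 (None : option 'I_k); rewrite card_option card_ord => ->.
Qed.

(** * Caterpillars: the optimum and the bound on colourings *)

(** Edge [n] creates vertex [n.+1], so the bounds place [v i.+1] among the vertices created by the
    [i]-th block of [k.+1] edges. *)
Definition spine (k : nat) (v : nat -> nat) : Prop :=
  v 0 = 0 /\ forall i, i * k.+1 < v i.+1 <= i.+1 * k.+1.

(* Edges [i * k.+1, ..., i * k.+1 + k] join the [i]-th spine vertex [v i] to its
   children; edge [(v i.+1).-1] is the one leading to the next spine vertex. *)
Definition caterpillar (k : nat) (v : nat -> nat) (n : nat) : nat := v (n %/ k.+1).

Section Caterpillar.
Variables (k : nat) (v : nat -> nat).
Hypothesis v_spine : spine k v.

Lemma spine_le i : v i <= i * k.+1.
Proof. by case: i => [|i]; [rewrite v_spine.1 | case/andP: (v_spine.2 i)]. Qed.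

Lemma spine_lt i j : i < j -> v i < v j.
Proof.
case: j => // j; rewrite ltnS => ij.
have [lt_v _] := andP (v_spine.2 j).
by apply: leq_ltn_trans lt_v; apply: leq_trans (spine_le i) _; rewrite leq_mul2r ij orbT.
Qed.

Lemma spine_inj : injective v.
Proof.
move=> i j vij; case: (ltngtP i j) => // /spine_lt; by rewrite vij ltnn.
Qed.

Lemma caterpillar_le n : caterpillar k v n <= n.
Proof. exact: leq_trans (spine_le _) (leq_divM _ _). Qed.

Lemma divn_block i n : i * k.+1 <= n < i.+1 * k.+1 -> n %/ k.+1 = i.
Proof.
move=> /andP[le_n n_lt]; apply/eqP; rewrite eqn_leq -ltnS.
by rewrite ltn_divLR // n_lt leq_divRL.
Qed.

Lemma spine_edge_block i : (v i.+1).-1 %/ k.+1 = i.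
Proof. by apply: divn_block; have := v_spine.2 i; lia. Qed.

Lemma count_block (P : pred nat) m :
  count P (iota 0 (m.+1 * k.+1)) =
  count P (iota 0 (m * k.+1)) + count P (iota (m * k.+1) k.+1).
Proof. by rewrite mulSn addnC iotaD count_cat. Qed.

Lemma OPT_caterpillar m :
  m * k <= OPT k (parent_seq (caterpillar k v) (m * k.+1)).
Proof.
(* [skip n] is the offset of the spine edge within the block of [n]. The colouring [g] rejects that
   edge and colours the others by rank, [unbump] closing the gap. *)
pose skip n := (v (n %/ k.+1).+1).-1 %% k.+1.
pose g n : option 'I_k :=
  if n %% k.+1 == skip n then None else insub (unbump (skip n) (n %% k.+1)).
have unbump_lt n : n %% k.+1 != skip n -> unbump (skip n) (n %% k.+1) < k.
  have := ltn_pmod n (ltn0Sn k).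
  have : skip n < k.+1 by exact: ltn_pmod.
  by rewrite /unbump; case: ltngtP; lia.
have gE n : (g n != None) = (n %% k.+1 != skip n).
  by rewrite /g; case: ifPn => // /unbump_lt lt_k; rewrite insubT.
have g_spine i : g (v i.+1).-1 = None.
  by apply/eqP; rewrite -[_ == _]negbK gE /skip spine_edge_block eqxx.
have g_proper : proper_decision (caterpillar k v) g.
  move=> a b ab adj ga; apply/eqP => gab.
  have gb : g b != None by rewrite -gab.
  (* The lower end of a coloured edge is never a spine vertex, so two coloured edges can meet only
     in a common parent, where their ranks differ. *)
  have not_spine n i : g n != None -> n.+1 <> v i.
    by case: i => [|i gn vn]; [rewrite v_spine.1 | rewrite -(g_spine i) -vn eqxx in gn].
  move: adj; rewrite adjacent_parent_edge (negPf ab) orbF => /or3P[] /eqP.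
  - move=> /spine_inj Eab; case/eqP: ab.
    have Es : skip a = skip b by rewrite /skip Eab.
    move: gab; rewrite /g; move: (ga) (gb); rewrite !gE => na nb.
    rewrite (negPf na) (negPf nb) !insubT ?unbump_lt // => _ _ [].
    move=> /(congr1 (bump (skip a))); rewrite {3}Es !unbumpK //.
    by move=> Em; rewrite (divn_eq a k.+1) Eab Em -divn_eq.
  - by move/esym; apply: not_spine.
  - exact: not_spine.
pose c : coloring k (parent_seq (caterpillar k v) (m * k.+1)) := [ffun i => g (val i)].
have c_proper : proper_coloring c by exact: proper_decision_coloring.
apply: leq_trans (leq_bigmax_cond c c_proper).
rewrite (colored_count (D := g)) => [|i]; last by rewrite ffunE.
rewrite size_mkseq; elim: m {c c_proper} => // m IHm.
rewrite count_block mulSn addnC leq_add //.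
rewrite -[X in iota X]addn0 iotaDl count_map.
pose s := (v m.+1).-1 %% k.+1.
rewrite (@eq_in_count _ _ (predC (pred1 s))) => [|j]; last first.
  rewrite mem_iota /= gE /skip => j_lt.
  by rewrite divnMDl // divn_small // addn0 modnMDl modn_small.
have := count_predC (pred1 s) (iota 0 k.+1).
by rewrite (count_uniq_mem _ (iota_uniq _ _)) mem_iota ltn_pmod // size_iota; lia.
Qed.

(* A coloured spine edge costs both its ends a colour; if a spine edge stays
   uncoloured, then so does everything else below its upper end. *)
Lemma count_caterpillar (D : nat -> option 'I_k) m :
  2 <= k -> proper_decision (caterpillar k v) D ->
  (forall i, i < m -> D (v i.+1).-1 = None -> forall n, n %/ k.+1 = i -> D n = None) ->
  count (fun n => D n != None) (iota 0 (m * k.+1)) <= (m * k.-1).+1.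
Proof.
move=> k2 D_proper D_spine.
have [B EB] : exists B, B = fun l : seq nat => count (fun n => D n != None) l by eexists.
(* The second conjunct strengthens the induction: if the edge into [v m] is uncoloured, the last
   block is empty and saves [k.-1 >= 1], which pays for the [k]-th colour then available to the next
   block. *)
suff [] : B (iota 0 (m * k.+1)) <= (m * k.-1).+1 /\
    (0 < m -> D (v m).-1 = None -> B (iota 0 (m * k.+1)) + k.-1 <= (m * k.-1).+1).
  by rewrite EB.
elim: m D_spine => [|m IHm] D_spine; first by rewrite EB.
have {IHm} [IH IHnone] := IHm (fun i im => D_spine i (ltnW im)).
have -> : B (iota 0 (m.+1 * k.+1)) =
    B (iota 0 (m * k.+1)) + B (iota (m * k.+1) k.+1) by rewrite EB count_block.
rewrite mulSn.
have block n : n \in iota (m * k.+1) k.+1 -> n %/ k.+1 = m.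
  by rewrite mem_iota => n_m; apply: divn_block; rewrite mulSn addnC.
have incident_block n : n \in iota (m * k.+1) k.+1 ->
    v m \in incident (parent_edge (caterpillar k v) n).
  by move=> /block n_m; rewrite inE /= /caterpillar n_m eqxx.
split=> [|_ Dnone].
  have Bk : B (iota (m * k.+1) k.+1) <= k.
    by rewrite EB; exact: proper_count D_proper (iota_uniq _ _) incident_block.
  (* The root has no edge above it and may use all [k] colours, whence the extra one in the
     bound. *)
  have [m0|m0] := posnP m.
    by have B0 : B (iota 0 (m * k.+1)) = 0; [rewrite EB m0 | lia].
  have [Dnone|Dsome] := eqVneq (D (v m).-1) None.
    by have := IHnone m0 Dnone; lia.
  have vm_gt0 : 0 < v m by exact: leq_ltn_trans (leq0n _) (spine_lt m0).
  have vm_le := spine_le m.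
  have Bk1 : B ((v m).-1 :: iota (m * k.+1) k.+1) <= k.
    rewrite EB; apply: (proper_count (u := v m) D_proper) => [|n].
      by rewrite cons_uniq iota_uniq andbT mem_iota; lia.
    rewrite inE => /orP[/eqP->|]; last exact: incident_block.
    by rewrite !inE /= prednK // eqxx orbT.
  have Bcons : B ((v m).-1 :: iota (m * k.+1) k.+1) = (B (iota (m * k.+1) k.+1)).+1.
    by rewrite EB /= Dsome.
  by lia.
have -> : B (iota (m * k.+1) k.+1) = 0; last by lia.
rewrite EB (eq_in_count (a2 := pred0)) ?count_pred0 // => n /block n_m.
by rewrite (D_spine m (ltnSn m) Dnone n n_m).
Qed.

End Caterpillar.

(** * Choice of the spine against fair and deterministic algorithms *)

Definition first_child_spine (k i : nat) : nat :=
  if i is j.+1 then (j * k.+1).+1 else 0.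

Lemma spine_first_child k : spine k (first_child_spine k).
Proof. by split=> // i /=; rewrite ltnS leqnn mulSn; lia. Qed.

(* When it arrives, the first child edge of a spine vertex is adjacent to at most
   one earlier edge, hence sees fewer than [k] colours. *)
Lemma fair_first_child (Omega : Type) k (ALG : Omega -> strategy k) v w i :
  2 <= k -> spine k v -> fair ALG ->
  decision (ALG w) (caterpillar k v) (i * k.+1) <> None.
Proof.
move=> k2 v_spine ALG_fair Dnone; set n := i * k.+1 in Dnone.
have tN := tree_parent_seq n.+1 (caterpillar_le v_spine).
have n_lt : n < size (parent_seq (caterpillar k v) n.+1) by rewrite size_mkseq.
have := ALG_fair w _ tN (Ordinal n_lt); rewrite run_parent_seq => /(_ Dnone) blocked.
(* After a rejection every colour occurs on an earlier adjacent edge, which can only be the edge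
   into [v i]; that edge would carry both colours 0 and 1. *)
have pred_color a : decision (ALG w) (caterpillar k v) (v i).-1 = Some a.
  have [j [jn]] := blocked a.
  rewrite !edge_at_parent_seq run_parent_seq adjacent_parent_edge /= in jn *.
  move=> adj <-; congr (decision _ _ _); move: adj.
  have n_i : caterpillar k v n = v i by rewrite /caterpillar mulnK.
  rewrite n_i => /or4P[] /eqP Ej.
  - have := spine_inj v_spine Ej.
    by move=> j_i; move: jn; rewrite /n -ltn_divLR // j_i ltnn.
  - by have := caterpillar_le v_spine j; rewrite Ej ltnNge (ltnW jn).
  - by rewrite -Ej.
  - by rewrite Ej ltnn in jn.
by have := pred_color (Ordinal (ltnW k2)); rewrite (pred_color (Ordinal k2)) => -[].
Qed.

(** This is what lets the adversary pick later parents after seeing earlier decisions. *)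
Lemma eq_decision k (A : strategy k) p q n :
  (forall j, j <= n -> p j = q j) -> decision A p n = decision A q n.
Proof.
move=> pq; rewrite /decision /parent_edge (pq n) //; congr (A _ _).
apply/eq_in_map => j; rewrite mem_iota /= add0n => /ltnW jn.
by rewrite /parent_edge pq.
Qed.

(* The adversary continues the spine along a coloured child whenever there is one. *)
Lemma adversarial_spine k (A : strategy k) m :
  exists2 v, spine k v & forall i, i < m ->
    decision A (caterpillar k v) (v i.+1).-1 = None ->
    forall n, n %/ k.+1 = i -> decision A (caterpillar k v) n = None.
Proof.
elim: m => [|m [v v_spine IHv]].
  by exists (first_child_spine k); [exact: spine_first_child|].
have [/hasP[c]|/hasPn none] :=
    boolP (has (fun n => decision A (caterpillar k v) n != None) (iota (m * k.+1) k.+1)).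
  rewrite mem_iota => c_m Dc.
  (* The value at [m.+1] is first read in block [m.+1], so changing it preserves all decisions in
     blocks up to [m]. *)
  pose v' i := if i == m.+1 then c.+1 else v i.
  have v'_spine : spine k v'.
    split=> [|i]; first exact: v_spine.1.
    by rewrite /v' eqSS; case: eqP => [->|_]; [rewrite mulSn; lia | exact: v_spine.2].
  have eqD n : n < m.+1 * k.+1 ->
      decision A (caterpillar k v') n = decision A (caterpillar k v) n.
    move=> n_m; apply: eq_decision => j jn; rewrite /caterpillar /v' ltn_eqF //.
    by rewrite ltn_divLR //; exact: leq_ltn_trans jn n_m.
  exists v' => // i; rewrite ltnS leq_eqVlt => /orP[/eqP->|im].
    rewrite /v' eqxx /= eqD; last by rewrite mulSn; lia.
    by move=> Dc'; rewrite Dc' eqxx in Dc.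
  have v'i : v' i.+1 = v i.+1 by rewrite /v' eqSS ltn_eqF.
  have lt_block n : n %/ k.+1 = i -> n < m.+1 * k.+1.
    by rewrite -ltn_divLR // => ->; apply: ltnW.
  rewrite v'i eqD; last by apply: lt_block; exact: spine_edge_block.
  by move=> Dnone n n_i; rewrite eqD ?lt_block //; exact: IHv Dnone n n_i.
exists v => // i; rewrite ltnS leq_eqVlt => /orP[/eqP->|]; last exact: IHv.
move=> _ n n_m; apply/eqP; rewrite -[_ == _]negbK; apply: none.
rewrite mem_iota -n_m leq_divM /= addnC -mulSn.
exact: ltn_ceil.
Qed.

(** One input serves all outcomes [w]: a deterministic algorithm ignores [w], and the first-child
    spine works against every fair run. *)
Lemma hard_tree (d : measure_display) (Omega : measurableType d) k
    (ALG : Omega -> strategy k) m :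
  2 <= k -> online_tree_algorithm ALG -> deterministic ALG \/ fair ALG ->
  exists s, [/\ tree_input s, m * k <= OPT k s
    & forall w, colored (run (ALG w) s) <= (m * k.-1).+1].
Proof.
move=> k2 [_ ALG_proper] ALG_class.
have [v v_spine v_good] : exists2 v, spine k v & forall w i, i < m ->
    decision (ALG w) (caterpillar k v) (v i.+1).-1 = None ->
    forall n, n %/ k.+1 = i -> decision (ALG w) (caterpillar k v) n = None.
  case: ALG_class => [[A ALG_A]|ALG_fair].
    have [v v_spine v_good] := adversarial_spine A m; exists v => // w i im.
    rewrite /decision ALG_A => Dnone n n_i; rewrite ALG_A; exact: v_good Dnone n n_i.
  exists (first_child_spine k); first exact: spine_first_child.
  move=> w i _ Dnone; case: (fair_first_child (i := i) k2 _ ALG_fair Dnone).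
  exact: spine_first_child.
have v_le := caterpillar_le v_spine.
exists (parent_seq (caterpillar k v) (m * k.+1)); split.
- exact: tree_parent_seq.
- exact: OPT_caterpillar.
move=> w; rewrite (colored_count (D := decision (ALG w) (caterpillar k v))) => [|i].
  rewrite size_mkseq; apply: (count_caterpillar v_spine) => //; last exact: v_good.
  by apply: proper_decision_run => //; exact: ALG_proper.
exact: run_parent_seq.
Qed.

(** * Expectation and the limit of long spines *)

Local Open Scope classical_set_scope.
Local Open Scope ring_scope.

Lemma expected_colored_le (R : realType) (d : measure_display)
    (Omega : measurableType d) (P : probability Omega R) k
    (ALG : Omega -> strategy k) s (M : nat) :
  online_tree_algorithm ALG -> (forall w, colored (run (ALG w) s) <= M)%N ->
  (expected_colored P ALG s <= M%:R%:E)%E.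
Proof.
move=> [ALG_meas _] ALG_le; rewrite -(expectation_cst P M%:R).
apply: expectation_le => [||w|w|]; rewrite ?ler0n //; last first.
  by apply: aeW => w /=; rewrite ler_nat.
(* Measurability: the number of coloured edges is a finite sum of indicators of the events that edge
   [i] is accepted. *)
pose F (i : 'I_(size s)) := ~` [set w | ALG w (take i s) (edge_at i) = None].
have F_meas i : measurable (F i) by exact/measurableC/ALG_meas.
suff -> : (fun w => (colored (run (ALG w) s))%:R : R) =
    (fun w => \sum_(i < size s) \1_(F i) w).
  by apply: measurable_sum => i; exact: measurable_indic.
apply/funext => w; rewrite /colored -sum1_card natr_sum big_mkcond.
apply: eq_bigr => i _; rewrite inE ffunE indicE /F in_setC.
case: eqP => [Dnone|Dsome]; first by rewrite mem_set.
by rewrite memNset.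
Qed.

Theorem theorem3 (R : realType) (d : measure_display) (Omega : measurableType d)
    (P : probability Omega R) (k : nat) (ALG : Omega -> strategy k) :
  (2 <= k)%N ->
  online_tree_algorithm ALG ->
  deterministic ALG \/ fair ALG ->
  (tree_competitive_ratio P ALG <= ((k%:R - 1) / k%:R)%:E)%E.
Proof.
move=> k2 ALG_online ALG_class; apply: ge_ereal_sup => _ [C [b C_b] <-].
have k0 : (0 < k%:R :> R) by rewrite ltr0n; lia.
rewrite lee_fin ler_pdivlMr // leNgt; apply/negP => C_gt.
(* The sign of [C] allows [OPT k s] to be replaced by its lower bound [m * k]. *)
have C_ge0 : 0 <= C.
  rewrite -(pmulr_lge0 _ k0); apply: le_trans (ltW C_gt).
  by rewrite subr_ge0 ler1n; lia.
(* [e] is the excess per spine vertex: competitiveness would give [m * e <= b + 1] for every [m],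
   which fails once [m] exceeds [|b + 1| / e]. *)
pose e := C * k%:R - (k%:R - 1).
have e0 : 0 < e by rewrite subr_gt0.
pose m := Num.bound (`|b + 1| / e).
have := @archi_boundP _ (`|b + 1| / e) (divr_ge0 (normr_ge0 _) (ltW e0)).
rewrite -/m ltr_pdivrMr // => m_big.
have [s [s_tree s_OPT s_ALG]] := hard_tree m k2 ALG_online ALG_class.
have := le_trans (C_b s s_tree) (expected_colored_le P ALG_online s_ALG).
rewrite lee_fin -addn1 natrD natrM -subn1 natrB ?(ltnW k2) // => C_ub.
have : C * (m * k)%:R <= C * (OPT k s)%:R by rewrite ler_wpM2l // ler_nat.
have := ler_norm (b + 1); rewrite natrM /e in m_big *; lra.
Qed.
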